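(* There exist absolute constants $C_1, C_2>0$ with the following property. Let $\Omega\subset\mathbb{R}^d$ be compact, let $\mu$ be a probability measure on $\Omega$, and let $X_N\subset\mathcal{C}(\Omega)$ be a linear subspace of (complex-valued) continuous functions which is $N$-dimensional as a subspace of $L_2(\Omega,\mu)$. Let $\{u_1,\dots,u_N\}$ be any orthonormal basis of $X_N$ in $L_2(\Omega,\mu)$ and put $w(\mathbf{x}):=(|u_1(\mathbf{x})|^2+\dots+|u_N(\mathbf{x})|^2)^{1/2}$. Then there exists a set of $m\le C_1N$ points $\xi^1,\dots,\xi^m\in\Omega$ such that for every $f\in X_N$ $$ \sup_{\mathbf{x}\in\Omega,\ w(\mathbf{x})>0}\frac{|f(\mathbf{x})|}{w(\mathbf{x})}\le C_2\max_{1\le j\le m}|f(\xi^j)|, $$ and, in particular, $$ \|f\|_\infty\le C_2\,\|w\|_\infty\,\max_{1\le j\le m}|f(\xi^j)|, $$ where $\|g\|_\infty=\max_{\mathbf{x}\in\Omega}|g(\mathbf{x})|$.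
   Context: $\mathcal{C}(\Omega)$ is the space of continuous functions on $\Omega$ with the uniform norm $\|f\|_\infty=\max_{\mathbf x\in\Omega}|f(\mathbf x)|$. $L_2(\Omega,\mu)$ has inner product $\langle f,g\rangle=\int_\Omega f\bar g\,d\mu$. The function $w$ does not depend on the choice of orthonormal basis. If $w(\mathbf x)=0$ then every $f\in X_N$ vanishes at $\mathbf x$. *)

(* Defs.v *)
From HB Require Import structures.
From mathcomp Require Import all_boot all_order all_algebra.
From mathcomp Require Import all_classical all_reals all_analysis.
From mathcomp Require Import Rstruct Rstruct_topology.
From mathcomp.real_closed Require Import complex.
Set Implicit Arguments. Unset Strict Implicit. Unset Printing Implicit Defensive.
Import Order.TTheory GRing.Theory Num.Theory.
Import numFieldNormedType.Exports.
Local Open Scope classical_set_scope.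
Local Open Scope ring_scope.

Notation R := Rdefinitions.R.

Notation Rd d := 'rV[R]_d.

Notation BorelRd d := (g_sigma_algebraType (@open (Rd d))).

Definition cabs (z : R[i]) : R := Num.sqrt (complex.Re z ^+ 2 + complex.Im z ^+ 2).

Definition ccontinuous_on d (Omega : set (Rd d)) (f : Rd d -> R[i]) : Prop :=
  {within Omega, continuous (fun x => complex.Re (f x))} /\
  {within Omega, continuous (fun x => complex.Im (f x))}.

Definition L2inner d (mu : {measure set (BorelRd d) -> \bar R}) (Omega : set (Rd d))
  (f g : Rd d -> R[i]) : R[i] :=
  Complex
    (Rintegral mu Omega (fun x : BorelRd d => complex.Re (f x * conjc (g x))))
    (Rintegral mu Omega (fun x : BorelRd d => complex.Im (f x * conjc (g x)))).

Definition lincomb d N (c : 'I_N -> R[i]) (u : 'I_N -> Rd d -> R[i]) : Rd d -> R[i] :=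
  fun x => \sum_(i < N) c i * u i x.

Definition wfun d N (u : 'I_N -> Rd d -> R[i]) (x : Rd d) : R :=
  Num.sqrt (\sum_(i < N) cabs (u i x) ^+ 2).

Definition supnorm d (Omega : set (Rd d)) (g : Rd d -> R) : R :=
  sup [set `|g x| | x in Omega].

Definition maxabs d m (f : Rd d -> R[i]) (xi : 'I_m -> Rd d) : R :=
  \big[Num.max/0]_(j < m) cabs (f (xi j)).

(* Main.v *)
(* By Cauchy-Schwarz |f| <= w ||f||_2, so it suffices to find m <= 6 N points
   with N ||f||_2^2 <= sum_j |f(xi_j)|^2, which is at most 6 N max_j |f(xi_j)|^2.
   Writing V(x) for the conjugate row of (u_i(x))_i, this asks for
   sum_j V(xi_j)^* V(xi_j) >= N.  The points are chosen greedily by the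
   lower-barrier half of the Batson-Spielman-Srivastava argument: A being the
   current sum and l = - N + k / 3 the barrier after k steps, the potential
   tr (A - l)^-1 equals 1 at the start and can be kept <= 1.  The condition on
   the next point is 1 <= V(x) G V(x)^* for an explicit Hermitian G with
   tr G >= 2; as the integral of V^* V is the identity, tr G is the mean of
   this form, so a suitable x exists.  After 6 N steps the barrier is l = N. *)
Require Import Defs.
From HB Require Import structures.
From mathcomp Require Import all_boot all_order all_algebra.
From mathcomp Require Import all_classical all_reals all_analysis.
From mathcomp Require Import Rstruct Rstruct_topology.
From mathcomp.real_closed Require Import complex.
From mathcomp Require Import ring lra.
Set Implicit Arguments.
Unset Strict Implicit.
Unset Printing Implicit Defensive.
Import Order.TTheory GRing.Theory Num.Theory.
Import numFieldNormedType.Exports.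
Local Open Scope classical_set_scope.
Local Open Scope ring_scope.
Local Open Scope sesquilinear_scope.

(** * The lower barrier *)

(** The scalar core of a barrier step: [a] and [b] are the eigenvalues of the current sum minus the
    barrier, before and after the barrier rises by 1/3, and [D] is the resulting growth of the
    potential. The last inequality is what yields [2 <= \tr G] in [barrier_step]. *)
Lemma barrier_shift_sums (F : numFieldType) (n : nat) (a : 'I_n.+1 -> F)
    (b := fun k => a k - 3^-1)
    (D := \sum_k (b k)^-1 - \sum_k (a k)^-1) :
  (forall k, 0 < a k) -> \sum_k (a k)^-1 <= 1 ->
  [/\ forall k, 0 < b k, 0 < D &
      (2 + \sum_k (b k)^-1) * D <= \sum_k (b k)^-1 ^+ 2].
Proof.
move=> a0 sa.
(* Each reciprocal is at most the whole sum, so the shift by 1/3 keeps every term positive. *)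
have a1 k : 1 <= a k.
  rewrite -invf_le1 //; apply: le_trans sa.
  by rewrite (bigD1 k) //= lerDl sumr_ge0 // => i _; rewrite invr_ge0 ltW.
have b0 k : 0 < b k.
  by rewrite subr_gt0; apply: lt_le_trans (a1 k); rewrite invf_lt1 ?ltr0n ?ltr1n.
have DE : D = 3^-1 * \sum_k (a k)^-1 * (b k)^-1.
  rewrite /D -sumrB mulr_sumr; apply: eq_bigr => k _.
  have := gt_eqF (b0 k); have := gt_eqF (a0 k).
  have -> : a k = b k + 3^-1 by rewrite subrK.
  by move: (b k) 3^-1 => y t yt0 y0; field; rewrite yt0 y0.
set m := \sum_k (a k)^-1 * (b k)^-1 in DE *.
have m0 : 0 < m.
  rewrite /m (bigD1 ord0) //= ltr_pwDl ?sumr_ge0 // => [|i _].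
    by rewrite mulr_gt0 ?invr_gt0.
  by rewrite mulr_ge0 ?invr_ge0 // ltW.
have D0 : 0 < D by rewrite DE mulr_gt0 ?invr_gt0 ?ltr0n.
split => //.
set X := \sum_k (a k)^-1 * (b k)^-1 ^+ 2.
(* Jensen's inequality for the sub-probability weights [1 / a k]. *)
have jensen : m ^+ 2 <= X.
  have jensen0 : 0 <= \sum_k (a k)^-1 * ((b k)^-1 - m) ^+ 2.
    apply: sumr_ge0 => k _; rewrite mulr_ge0 ?invr_ge0 ?(ltW (a0 k)) //.
    (* The order of [F] is partial: a square is nonnegative only when its base is real. *)
    by rewrite -realEsqr rpredB ?gtr0_real ?invr_gt0.
  have jensenE : \sum_k (a k)^-1 * ((b k)^-1 - m) ^+ 2 =
      X - 2 * m * m + m ^+ 2 * \sum_k (a k)^-1.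
    rewrite [2 * m * _]mulr_sumr [m ^+ 2 * _]mulr_sumr -sumrB -big_split /=.
    by apply: eq_bigr => k _; ring.
  have -> : X = m ^+ 2 + ((X - 2 * m * m + m ^+ 2 * \sum_k (a k)^-1) +
      m ^+ 2 * (1 - \sum_k (a k)^-1)) by ring.
  rewrite lerDl -jensenE addr_ge0 // mulr_ge0 ?exprn_ge0 ?(ltW m0) //.
  by rewrite subr_ge0.
(* Termwise this is [b^-1 = a^-1 + 3^-1 (a b)^-1] divided by [b]. *)
have S2 : \sum_k (b k)^-1 ^+ 2 = m + 3^-1 * X.
  rewrite mulr_sumr -big_split /=; apply: eq_bigr => k _.
  have := gt_eqF (b0 k); have := gt_eqF (a0 k).
  have -> : a k = b k + 3^-1 by rewrite subrK.
  by move: (b k) 3^-1 => y t yt0 y0; field; rewrite yt0 y0.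
have sb : \sum_k (b k)^-1 = D + \sum_k (a k)^-1 by rewrite /D subrK.
rewrite S2 sb DE -subr_ge0.
(* Three nonnegative terms: the slack in the potential bound, the slack in Jensen's inequality, and
   a multiple of [m ^+ 2]. *)
have -> : m + 3^-1 * X - (2 + (3^-1 * m + \sum_k (a k)^-1)) * (3^-1 * m) =
    3^-1 * m * (1 - \sum_k (a k)^-1) + 3^-1 * (X - m ^+ 2) +
    3^-1 ^+ 2 * 2 * m ^+ 2 by field.
have third0 : 0 <= 3^-1 :> F by rewrite invr_ge0 ler0n.
rewrite !addr_ge0 ?mulr_ge0 ?subr_ge0 ?exprn_ge0 ?ler0n //; exact: ltW.
Qed.

(** Functional calculus in a fixed eigenbasis, the rows of a unitary [P]. Values are indexed by
    eigenvector, so identities between functions of one matrix reduce to scalar ones. *)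
Definition spec_fun (C : numClosedFieldType) n (P : 'M[C]_n) (f : 'I_n -> C) :
  'M[C]_n := P^t* *m diag_mx (\row_k f k) *m P.

Section spec_fun.
Variables (C : numClosedFieldType) (n : nat) (P : 'M[C]_n).
Hypothesis PU : P \is unitarymx.
Local Notation S := (spec_fun P).

Lemma spec_funM f g : S f *m S g = S (fun k => f k * g k).
Proof.
rewrite /spec_fun !mulmxA mulmxtVK //; congr (_ *m _).
rewrite -!mulmxA mulmx_diag; congr (_ *m diag_mx _).
by apply/rowP => k; rewrite !mxE.
Qed.

Lemma spec_fun_cst r : S (fun=> r) = r%:M.
Proof.
rewrite /spec_fun (_ : \row_k _ = const_mx r); last first.
  by apply/rowP => k; rewrite !mxE.
rewrite diag_const_mx mul_mx_scalar -scalemxAl.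
rewrite -invmx_unitary // mulVmx ?unitarymx_unit //.
by rewrite scalemx1.
Qed.

Lemma spec_fun_comb r s f g :
  S (fun k => r * f k + s * g k) = r *: S f + s *: S g.
Proof.
rewrite /spec_fun.
have -> : diag_mx (\row_k (r * f k + s * g k)) =
    r *: diag_mx (\row_k f k) + s *: diag_mx (\row_k g k).
  by apply/matrixP => i j; rewrite !mxE mulrnDl !mulrnAr.
by rewrite mulmxDr mulmxDl -!scalemxAr -!scalemxAl.
Qed.

Lemma mxtrace_spec_fun f : \tr (S f) = \sum_k f k.
Proof.
rewrite /spec_fun mxtrace_mulC mulmxA (unitarymxP PU) mul1mx mxtrace_diag.
by apply: eq_bigr => k _; rewrite mxE.
Qed.

Lemma spec_fun_adj f : (S f)^t* = S (fun k => Num.conj (f k)).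
Proof.
rewrite /spec_fun !trmx_mul !map_mxM trmxCK mulmxA tr_diag_mx map_diag_mx.
by congr (_ *m diag_mx _ *m _); apply/rowP => k; rewrite !mxE.
Qed.

Lemma spec_fun_form f (x : 'rV[C]_n) :
  (x *m S f *m x^t* ) 0 0 = \sum_k f k * `|(x *m P^t* ) 0 k| ^+ 2.
Proof.
have -> : x *m S f *m x^t* =
    (x *m P^t* ) *m diag_mx (\row_k f k) *m (x *m P^t* )^t*.
  by rewrite /spec_fun trmx_mul map_mxM trmxCK !mulmxA.
move: (x *m P^t* ) => y; rewrite mxE; apply: eq_bigr => k _.
by rewrite mul_mx_diag !mxE normCK [y 0 k * f k]mulrC mulrA.
Qed.

End spec_fun.

(** Multiplying out leaves [1 + (1 - s * (1 + q)) Z] with [Z = v w H] and [q = w H v]. Passing the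
    inverse of [1 + q] as [s] avoids division in [K]. *)
Lemma sherman_morrison (K : comUnitRingType) n (B H : 'M[K]_n) (v : 'cV_n)
    (w : 'rV_n) (s : K) :
  B *m H = 1%:M -> s * (1 + (w *m H *m v) 0 0) = 1 ->
  invmx (B + v *m w) = H - s *: (H *m v *m (w *m H)).
Proof.
move=> BH sE.
have BvwK : (B + v *m w) *m (H - s *: (H *m v *m (w *m H))) = 1%:M.
  rewrite mulmxDl !mulmxBr BH -!scalemxAr !mulmxA BH mul1mx.
  have -> : v *m w *m H *m v = (w *m H *m v) 0 0 *: v.
    by rewrite -mul_mx_scalar -mx11_scalar !mulmxA.
  rewrite -!scalemxAl scalerA -addrA -[RHS]addr0; congr (_ + _).
  move: (v *m w *m H) ((w *m H *m v) 0 0) sE => Z q sE.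
  by rewrite addrCA -opprD -scalerDl -{1}[s]mulr1 -mulrDr sE scale1r subrr.
have [BvwU _] := mulmx1_unit BvwK.
by rewrite -[LHS]mulmx1 -BvwK mulKmx.
Qed.

(** * One step of the barrier argument *)

Section barrier.
Variable C : numClosedFieldType.

(* [B] is the current sum minus the barrier. *)
Definition barrier n (B : 'M[C]_n) : Prop :=
  [/\ B^t* = B,
      forall x : 'rV_n, x != 0 -> 0 < (x *m B *m x^t* ) 0 0 &
      \tr (invmx B) <= 1].

Lemma herm_form_real n (G : 'M[C]_n) (x : 'rV[C]_n) :
  G^t* = G -> (x *m G *m x^t* ) 0 0 \is Num.real.
Proof.
move=> GH; apply/CrealP.
have <- : ((x *m G *m x^t* )^t* ) 0 0 = Num.conj ((x *m G *m x^t* ) 0 0).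
  by rewrite !mxE.
by rewrite !trmx_mul !map_mxM trmxCK GH mulmxA.
Qed.

(** The spectral theorem turns the barrier condition into one on eigenvalues, the input of
    [barrier_shift_sums]. *)
Lemma barrier_spectral n (B : 'M[C]_n) : barrier B ->
  exists (P : 'M[C]_n) (a : 'I_n -> C),
    [/\ P \is unitarymx, B = spec_fun P a, forall k, 0 < a k &
        \sum_k (a k)^-1 <= 1].
Proof.
case=> BH Bpos Btr.
have Bherm : B \is hermsymmx by apply/is_hermitianmxP; rewrite expr0 scale1r BH.
exists (spectralmx B), (fun k => spectral_diag B 0 k).
have PU := spectral_unitarymx B.
set P := spectralmx B in PU *; set a := fun k => _.
have BE : B = spec_fun P a.
  have /hermitian_normalmx /orthomx_spectralP {1}-> := Bherm.
  rewrite invmx_unitary // /spec_fun; congr (_ *m diag_mx _ *m _).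
  by apply/rowP => k; rewrite !mxE.
(* Row [k] of [P] is a unit eigenvector, at which the form takes the value [a k]. *)
have a0 k : 0 < a k.
  have rowP' : row k P *m P^t* = delta_mx 0 k.
    by rewrite -row_mul (unitarymxP PU) row1.
  have := Bpos (row k P); rewrite BE spec_fun_form // rowP'.
  rewrite (bigD1 k) //= big1 => [|j jk]; last first.
    by rewrite !mxE eqxx (negbTE jk) normr0 expr0n mulr0.
  rewrite !mxE !eqxx normr1 expr1n mulr1 addr0; apply.
  apply/eqP => /(congr1 (fun z => z *m P^t* )); rewrite rowP' mul0mx.
  by move=> /matrixP/(_ 0 k)/eqP; rewrite !mxE !eqxx oner_eq0.
split => //.
have BV : B *m spec_fun P (fun k => (a k)^-1) = 1%:M.
  rewrite BE spec_funM // -(spec_fun_cst PU); congr spec_fun.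
  by apply/funext => k; rewrite mulfV // gt_eqF.
have [BU _] := mulmx1_unit BV.
by rewrite -(mxtrace_spec_fun PU) -[spec_fun _ _](mulKmx BU) BV mulmx1.
Qed.

(* [G = H ^+ 2 / D - H], where [H] inverts [B - 3^-1] and [D] is the increase of
   the trace of the inverse due to the shift; by Sherman-Morrison the condition
   on [x] says that the rank one update lowers that trace by at least [D]. *)
Lemma barrier_step n (B : 'M[C]_n.+1) : barrier B ->
  exists G : 'M[C]_n.+1, [/\ G^t* = G, 2 <= \tr G &
    forall x : 'rV_n.+1, 1 <= (x *m G *m x^t* ) 0 0 ->
      barrier (B - (3^-1)%:M + x^t* *m x)].
Proof.
move=> /barrier_spectral [P [a [PU BE a0 sa]]].
pose b k := a k - 3^-1; pose D := \sum_k (b k)^-1 - \sum_k (a k)^-1.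
have [b0 D0 DS] : [/\ forall k, 0 < b k, 0 < D &
    (2 + \sum_k (b k)^-1) * D <= \sum_k (b k)^-1 ^+ 2].
  exact: barrier_shift_sums a0 sa.
pose H := spec_fun P (fun k => (b k)^-1).
pose H2 := spec_fun P (fun k => (b k)^-1 ^+ 2).
have B'E : B - (3^-1)%:M = spec_fun P b.
  rewrite BE -(spec_fun_cst PU) -[spec_fun P a]scale1r -scaleN1r.
  rewrite -spec_fun_comb; congr spec_fun.
  by apply/funext => k; rewrite mul1r mulN1r.
have B'H : (B - (3^-1)%:M) *m H = 1%:M.
  rewrite B'E spec_funM // -(spec_fun_cst PU); congr spec_fun.
  by apply/funext => k; rewrite mulfV // gt_eqF.
have HH : H *m H = H2.
  by rewrite spec_funM.
have adj f : (forall k, f k \is Num.real) -> (spec_fun P f)^t* = spec_fun P f.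
  move=> fR; rewrite spec_fun_adj; congr spec_fun.
  by apply/funext => k; apply/CrealP.
have bR k : (b k)^-1 \is Num.real by rewrite realV; exact: gtr0_real.
have DR : D^-1 \is Num.real by rewrite realV; exact: gtr0_real.
exists (D^-1 *: H2 + (-1) *: H); split.
- rewrite -spec_fun_comb adj // => k.
  by rewrite mulN1r rpredB ?rpredM ?rpredX.
(* The trace is [\sum b^-1 ^+ 2 / D - \sum b^-1], so the bound is [DS]. *)
- rewrite linearD !linearZ /= !mxtrace_spec_fun // mulN1r.
  by rewrite lerBrDr [D^-1 * _]mulrC ler_pdivlMr.
move=> x; set q1 := (x *m H *m x^t* ) 0 0; set q2 := (x *m H2 *m x^t* ) 0 0.
have -> : (x *m (D^-1 *: H2 + -1 *: H) *m x^t* ) 0 0 = D^-1 * q2 - q1.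
  rewrite mulmxDr mulmxDl -!scalemxAr -!scalemxAl mxE.
  have scE (c : C) (M : 'M[C]_1) : (c *: M) 0 0 = c * M 0 0 by rewrite mxE.
  by rewrite !scE mulN1r.
have q10 : 0 <= q1.
  rewrite /q1 spec_fun_form // sumr_ge0 // => k _.
  by rewrite mulr_ge0 ?exprn_ge0 // invr_ge0 ltW.
rewrite lerBrDr [D^-1 * _]mulrC ler_pdivlMr // => q12.
have q1p : 0 < 1 + q1 by rewrite ltr_pwDl.
split.
- rewrite linearD raddfD /= trmx_mul map_mxM trmxCK B'E adj // => k.
  by rewrite gtr0_real.
- move=> y y0; rewrite mulmxDr mulmxDl mxE B'E ltr_pwDl //.
    rewrite spec_fun_form //.
    have : y *m P^t* != 0.
      apply: contra y0 => /eqP /(congr1 (fun z => z *m P)).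
      by rewrite mul0mx mulmxKtV // => ->.
    move=> /rV0Pn[k yk]; rewrite (bigD1 k) //= ltr_pwDl //.
      by rewrite mulr_gt0 // exprn_gt0 // normr_gt0.
    by rewrite sumr_ge0 // => j _; rewrite mulr_ge0 ?exprn_ge0 // ltW.
  have -> : y *m (x^t* *m x) *m y^t* = (y *m x^t* ) *m (y *m x^t* )^t*.
    by rewrite trmx_mul map_mxM trmxCK !mulmxA.
  by rewrite mxE big_ord1 !mxE mul_conjC_ge0.
(* The new trace is [\sum b^-1 - q2 / (1 + q1)]. By [q12] the subtracted term is at least [D], which
   brings the trace back to at most [\sum a^-1]. *)
rewrite (sherman_morrison (H := H) (s := (1 + q1)^-1)) //; last first.
  by rewrite mulVf // gt_eqF.
rewrite linearB linearZ /= mxtrace_spec_fun //.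
rewrite mxtrace_mulC mulmxA -(mulmxA x) HH /mxtrace big_ord1 -/q2.
apply: le_trans sa; rewrite lerBlDr -lerBlDl mulrC ler_pdivlMr //.
by rewrite mulrC.
Qed.

End barrier.

(** The hypothesis supplies the next point for whatever [G] the current state produces. The scalar
    matrix is minus the barrier, which starts at [- n.+1] and rises by 1/3 per step. *)
Lemma barrier_iterate (C : numClosedFieldType) n (T : Type) (Omega : T -> Prop)
    (V : T -> 'rV[C]_n.+1) :
  (forall G : 'M[C]_n.+1, G^t* = G -> 2 <= \tr G ->
    exists2 x, Omega x & 1 <= (V x *m G *m (V x)^t* ) 0 0) ->
  forall k, exists2 xi : 'I_k -> T, forall j, Omega (xi j) &
    barrier ((n.+1%:R - k%:R / 3)%:M + \sum_j (V (xi j))^t* *m V (xi j)).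
Proof.
move=> large; elim=> [|k [xi xiO xiB]].
  exists (fun j : 'I_0 => match notF (ltn_ord j) with end) => [[]//|].
  rewrite big_ord0 addr0 mul0r subr0; split.
  - by rewrite tr_scalar_mx map_scalar_mx /= rmorph_nat.
  - move=> x x0; rewrite mul_mx_scalar -scalemxAl mxE mulr_gt0 ?ltr0n //.
    have /rV0Pn[k xk] := x0.
    rewrite mxE (bigD1 k) //= ltr_pwDl //.
      by rewrite !mxE mul_conjC_gt0.
    by rewrite sumr_ge0 // => j _; rewrite !mxE mul_conjC_ge0.
  (* The initial potential is exactly 1: [n.+1] eigenvalues, each equal to [n.+1]. *)
  - by rewrite invmx_scalar mxtrace_scalar -(mulr_natr (_^-1)) mulVf // pnatr_eq0.
have [G [GH Gtr Gbar]] := barrier_step xiB.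
have [x Ox xG] := large G GH Gtr.
(* The new point takes the last index, to match [big_ord_recr]. *)
exists (fun j : 'I_k.+1 => if unlift ord_max j is Some i then xi i else x).
  by move=> j; case: unlift.
move: (Gbar _ xG); congr barrier.
rewrite big_ord_recr /= unlift_none addrA; congr (_ + _).
rewrite addrAC; congr (_ + _).
  by rewrite -raddfB /= -addrA -opprD -{2}(div1r 3) -mulrDl natr1.
apply: eq_bigr => j _; rewrite (_ : widen_ord _ j = lift ord_max j) ?liftK //.
by apply: val_inj; rewrite /= /bump leqNgt ltn_ord.
Qed.

(** After [6 * n.+1] steps the scalar part is [n.+1 - 2 * n.+1 = - n.+1]; positivity of the whole
    form at [c] is then the claimed bound, in strict form for nonzero [c]. *)
Lemma sampling_lower_bound (C : numClosedFieldType) n (T : Type)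
    (Omega : T -> Prop) (V : T -> 'rV[C]_n.+1) :
  (forall G : 'M[C]_n.+1, G^t* = G -> 2 <= \tr G ->
    exists2 x, Omega x & 1 <= (V x *m G *m (V x)^t* ) 0 0) ->
  exists2 xi : 'I_(6 * n.+1) -> T, forall j, Omega (xi j) &
    forall c : 'rV[C]_n.+1, n.+1%:R * \sum_i `|c 0 i| ^+ 2 <=
      \sum_j `|\sum_i c 0 i * Num.conj (V (xi j) 0 i)| ^+ 2.
Proof.
move=> /barrier_iterate/(_ (6 * n.+1)%N)[xi xiO [_ Bpos _]].
exists xi => // c.
have [->|c0] := eqVneq c 0.
  rewrite big1 => [|i _]; last by rewrite mxE normr0 expr0n.
  by rewrite mulr0 sumr_ge0 // => j _; rewrite exprn_ge0.
have := Bpos _ c0.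
have -> : n.+1%:R - (6 * n.+1)%:R / 3 = - n.+1%:R :> C.
  by rewrite natrM; field.
rewrite mulmxDr mulmxDl mxE mul_mx_scalar -scalemxAl.
have -> : (- n.+1%:R *: (c *m c^t* )) 0 0 = - (n.+1%:R * \sum_i `|c 0 i| ^+ 2).
  rewrite !mxE mulNr; congr (- (_ * _)).
  by apply: eq_bigr => i _; rewrite !mxE normCK.
rewrite addrC subr_gt0 => /ltW /le_trans; apply.
rewrite mulmx_sumr mulmx_suml summxE le_eqVlt; apply/orP; left; apply/eqP.
apply: eq_bigr => j _.
have -> : c *m ((V (xi j))^t* *m V (xi j)) *m c^t* =
    (c *m (V (xi j))^t* ) *m (c *m (V (xi j))^t* )^t*.
  by rewrite trmx_mul map_mxM trmxCK !mulmxA.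
rewrite mxE big_ord1 2![in X in _ * X]mxE -normCK mxE.
by congr (`|_| ^+ 2); apply: eq_bigr => i _; rewrite !mxE.
Qed.

(** * Continuous functions on compact sets *)

Section within_continuous.
Variables (K : realType) (T : topologicalType).
Implicit Types (Omega : set T) (f : T -> K).
Lemma within_continuousM Omega (f g : T -> K) :
  {within Omega, continuous f} -> {within Omega, continuous g} ->
  {within Omega, continuous (fun x => f x * g x)}.
Proof. by move=> cf cg x; apply: continuousM; [exact: cf|exact: cg]. Qed.
Lemma within_continuousB Omega (f g : T -> K) :
  {within Omega, continuous f} -> {within Omega, continuous g} ->
  {within Omega, continuous (fun x => f x - g x)}.
Proof. by move=> cf cg x; apply: continuousB; [exact: cf|exact: cg]. Qed.
Lemma within_continuousD Omega (f g : T -> K) :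
  {within Omega, continuous f} -> {within Omega, continuous g} ->
  {within Omega, continuous (fun x => f x + g x)}.
Proof. by move=> cf cg x; apply: continuousD; [exact: cf|exact: cg]. Qed.
Lemma within_continuous_cst Omega (c : K) :
  {within Omega, continuous (fun=> c)}.
Proof. by move=> x; exact: cst_continuous. Qed.

Lemma within_continuous_sum Omega (I : Type) (s : seq I) (f : I -> T -> K) :
  (forall i, {within Omega, continuous (f i)}) ->
  {within Omega, continuous (fun x => \sum_(i <- s) f i x)}.
Proof.
move=> cf; elim: s => [|i s IH].
  rewrite (_ : (fun _ => _) = fun=> 0); last first.
    by apply/funext => x; rewrite big_nil.
  exact: within_continuous_cst.
rewrite (_ : (fun _ => _) = fun x => f i x + \sum_(i <- s) f i x).
  exact: within_continuousD.
by apply/funext => x; rewrite big_cons.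
Qed.

End within_continuous.

Section borel.
Variables (K : realType) (T : ptopologicalType).
Hypothesis T_hausdorff : hausdorff_space T.
Local Notation Borel := (g_sigma_algebraType (@open T)).
Implicit Types (Omega : set T) (f : T -> K).

Lemma compact_borel Omega :
  compact Omega -> measurable (Omega : set Borel).
Proof.
move=> /(compact_closed T_hausdorff) /closed_openC oO.
rewrite -(setCK Omega); apply: measurableC.
exact: sub_sigma_algebra.
Qed.

(** Open rays generate the Borel sets of [K], and the preimage of one is the trace on [Omega] of an
    open set. *)
Lemma within_continuous_measurable Omega f :
  compact Omega -> {within Omega, continuous f} ->
  measurable_fun (Omega : set Borel) (f : Borel -> K).
Proof.
move=> /compact_borel mO /continuousP cf.
apply: (measurability _ (measurable_realfun.RGenOInfty.measurableE K)).
move=> _ [_ [a ->] <-].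
have /cf /open_subspaceP[V oV VE] : open `]a, +oo[%classic by exact: interval_open.
rewrite setIC -VE; apply: measurableI => //.
exact: sub_sigma_algebra.
Qed.

Lemma within_continuous_bounded Omega f :
  compact Omega -> {within Omega, continuous f} ->
  exists M, forall x, Omega x -> `|f x| <= M.
Proof.
move=> cO cf.
have /compact_bounded [M [_ HM]] := continuous_compact cf cO.
(* [HM] speaks only of bounds strictly above [M]. *)
exists (M + 1) => x Ox; apply: (HM (M + 1)); first by rewrite ltrDl.
by exists x.
Qed.

Lemma within_continuous_integrable (mu : probability Borel K) Omega f :
  compact Omega -> {within Omega, continuous f} ->
  mu.-integrable (Omega : set Borel) (EFin \o (f : Borel -> K)).
Proof.
move=> cO cf; have mO := compact_borel cO.
apply: measurable_bounded_integrable => //.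
- by rewrite (le_lt_trans (probability_le1 mu mO)) // ltry.
- exact: within_continuous_measurable.
- have [M fM] := within_continuous_bounded cO cf.
  exists M; split; first exact: num_real.
  by move=> y My x Ox /=; rewrite (le_trans (fM x Ox)) // ltW.
Qed.

End borel.

Lemma Rintegral_sum dd (T : measurableType dd) (F : realType)
    (mu : {measure set T -> \bar F}) (D : set T) (I : Type) (s : seq I)
    (f : I -> T -> F) :
  measurable D -> (forall i, mu.-integrable D (EFin \o f i)) ->
  Rintegral mu D (fun x => \sum_(i <- s) f i x) =
  \sum_(i <- s) Rintegral mu D (f i).
Proof.
move=> mD fi.
have si (r : seq I) :
    mu.-integrable D (EFin \o (fun x => \sum_(i <- r) f i x)).
  have -> : EFin \o (fun x => \sum_(i <- r) f i x) =
      (fun x => \sum_(i <- r) (EFin \o f i) x)%E.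
    by apply/funext => x /=; rewrite sumEFin.
  exact: integrable_sum.
elim: s => [|i s IH].
  rewrite big_nil (_ : (fun _ => _) = cst 0) ?Rintegral_cst ?mul0r //.
  by apply/funext => x; rewrite big_nil.
rewrite big_cons -IH -RintegralD //.
by congr Rintegral; apply/funext => x; rewrite big_cons.
Qed.

(** * Sampling *)

Section complex_parts.
Variable F : rcfType.
Implicit Types z w : F[i].

Lemma ReD z w : complex.Re (z + w) = complex.Re z + complex.Re w.
Proof. by case: z w => [a b] [c e]. Qed.

Lemma ReM z w : complex.Re (z * w) =
  complex.Re z * complex.Re w - complex.Im z * complex.Im w.
Proof. by case: z w => [a b] [c e]. Qed.

Lemma ImM z w : complex.Im (z * w) =
  complex.Re z * complex.Im w + complex.Im z * complex.Re w.
Proof. by case: z w => [a b] [c e]. Qed.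

Lemma Re_conjc z : complex.Re (conjc z) = complex.Re z.
Proof. by case: z. Qed.

Lemma Im_conjc z : complex.Im (conjc z) = - complex.Im z.
Proof. by case: z. Qed.

Lemma Re_sum (I : Type) (s : seq I) (f : I -> F[i]) :
  complex.Re (\sum_(i <- s) f i) = \sum_(i <- s) complex.Re (f i).
Proof. exact: (big_morph _ ReD). Qed.

End complex_parts.

(** Conjugated so that [c *m (conj_row u x)^t*] is the value at [x] of the combination with
    coefficients [c]. *)
Definition conj_row d N (u : 'I_N -> Rd d -> R[i]) (x : Rd d) : 'rV[R[i]]_N :=
  \row_i Num.conj (u i x).

(** Writes the form through the real integrands of [L2inner], ready for termwise integration. *)
Lemma conj_row_formE d N (u : 'I_N -> Rd d -> R[i]) (G : 'M[R[i]]_N) x :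
  complex.Re ((conj_row u x *m G *m (conj_row u x)^t* ) 0 0) =
  \sum_(p : 'I_N * 'I_N)
    (complex.Re (G p.1 p.2) * complex.Re (u p.2 x * conjc (u p.1 x)) -
     complex.Im (G p.1 p.2) * complex.Im (u p.2 x * conjc (u p.1 x))).
Proof.
rewrite -(pair_bigA _ (fun i j => complex.Re (G i j) *
    complex.Re (u j x * conjc (u i x)) - complex.Im (G i j) *
    complex.Im (u j x * conjc (u i x)))) /=.
rewrite mxE Re_sum exchange_big; apply: eq_bigr => j _ /=.
rewrite !mxE big_distrl Re_sum; apply: eq_bigr => i _ /=.
by rewrite -ReM !mxE conjCK -mulrA mulrC -mulrA.
Qed.

(** An averaging argument: the real part of the form has integral [Re (\tr G)], at least 2, whereas
    values below 1 throughout [Omega] would give at most 1. The gap makes weak monotonicity of the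
    integral enough. *)
Lemma conj_row_large_form d (Omega : set (Rd d))
    (mu : probability (BorelRd d) R) N (u : 'I_N -> Rd d -> R[i])
    (G : 'M[R[i]]_N) :
  compact Omega -> mu (Omega : set (BorelRd d)) = 1%E ->
  (forall i, ccontinuous_on Omega (u i)) ->
  (forall i j, L2inner mu Omega (u i) (u j) = (i == j)%:R) ->
  G^t* = G -> 2 <= \tr G ->
  exists2 x, Omega x & 1 <= (conj_row u x *m G *m (conj_row u x)^t* ) 0 0.
Proof.
move=> cO muO cu ou GH Gtr.
pose q x := complex.Re ((conj_row u x *m G *m (conj_row u x)^t* ) 0 0).
(* For Hermitian [G] the form is real, so it may be compared with 1 through its real part [q]. *)
have [//|no_x] := pselect (exists2 x, Omega x & 1 <= q x).
  case=> x Ox qx; exists x => //.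
  by rewrite -(RRe_real (herm_form_real (conj_row u x) GH)) lecR.
exfalso.
have haus : hausdorff_space (Rd d) by exact: norm_hausdorff.
have mO := compact_borel haus cO.
pose re (p : 'I_N * 'I_N) x := complex.Re (u p.2 x * conjc (u p.1 x)).
pose im (p : 'I_N * 'I_N) x := complex.Im (u p.2 x * conjc (u p.1 x)).
have cre p : {within Omega, continuous (re p)}.
  rewrite (_ : re p = fun x => complex.Re (u p.2 x) * complex.Re (u p.1 x) +
      complex.Im (u p.2 x) * complex.Im (u p.1 x)); last first.
    by apply/funext => x; rewrite /re ReM Re_conjc Im_conjc mulrN opprK.
  have [r2 i2] := cu p.2; have [r1 i1] := cu p.1.
  exact: (within_continuousD (within_continuousM r2 r1)
    (within_continuousM i2 i1)).
have cim p : {within Omega, continuous (im p)}.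
  rewrite (_ : im p = fun x => complex.Im (u p.2 x) * complex.Re (u p.1 x) -
      complex.Re (u p.2 x) * complex.Im (u p.1 x)); last first.
    by apply/funext => x; rewrite /im ImM Re_conjc Im_conjc mulrN addrC.
  have [r2 i2] := cu p.2; have [r1 i1] := cu p.1.
  exact: (within_continuousB (within_continuousM i2 r1)
    (within_continuousM r2 i1)).
have ire p := within_continuous_integrable haus mu cO (cre p).
have iim p := within_continuous_integrable haus mu cO (cim p).
pose t p x := complex.Re (G p.1 p.2) * re p x - complex.Im (G p.1 p.2) * im p x.
have ct p : {within Omega, continuous (t p)}.
  exact: (within_continuousB
    (within_continuousM (@within_continuous_cst R _ Omega _) (cre p))
    (within_continuousM (@within_continuous_cst R _ Omega _) (cim p))).
have it p := within_continuous_integrable haus mu cO (ct p).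
have qE : q = fun x => \sum_p t p x.
  by apply/funext => x; rewrite /q conj_row_formE.
have cq : {within Omega, continuous q}.
  by rewrite qE; exact: within_continuous_sum.
have : Rintegral mu (Omega : set (BorelRd d)) q <= Rintegral mu Omega (cst 1).
  apply: le_Rintegral => //.
  - exact: within_continuous_integrable.
  - apply: within_continuous_integrable => //.
    exact: within_continuous_cst.
  - by move=> x Ox; rewrite leNgt; apply/negP => /ltW qx; apply: no_x; exists x.
rewrite Rintegral_cst // [X in fine X](_ : _ = 1%E) // mulr1.
rewrite qE Rintegral_sum //.
(* Orthonormality, read on real and imaginary parts, leaves only the diagonal of [G]. *)
have tI p : Rintegral mu (Omega : set (BorelRd d)) (t p) =
    (if p.2 == p.1 then complex.Re (G p.1 p.2) else 0).
  have := ou p.2 p.1; rewrite /L2inner.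
  have iZ (c : R) f : {within Omega, continuous f} ->
      mu.-integrable (Omega : set (BorelRd d)) (EFin \o (fun x => c * f x)).
    move=> cf; apply: within_continuous_integrable => //.
    exact: (within_continuousM (@within_continuous_cst R _ Omega _) cf).
  rewrite /t RintegralB ?RintegralZl //; try exact: iZ.
  by case: eqP => _ [-> ->]; rewrite !mulr0 ?mulr1 subr0.
under eq_bigr do rewrite tI.
rewrite -(pair_bigA _ (fun i j => if j == i then complex.Re (G i j) else 0)) /=.
under eq_bigr do rewrite -big_mkcond big_pred1_eq.
rewrite -Re_sum.
by move: Gtr; rewrite lecE => /andP[_] /=; rewrite /mxtrace; lra.
Qed.

(** * From coefficients to pointwise bounds *)

Lemma normc_cabs (z : R[i]) : `|z| = (cabs z)%:C%C.
Proof. exact: normc_def. Qed.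

Lemma cabs_ge0 (z : R[i]) : 0 <= cabs z.
Proof. exact: sqrtr_ge0. Qed.

Lemma sqr_wfun d N (u : 'I_N -> Rd d -> R[i]) x :
  wfun u x ^+ 2 = \sum_i cabs (u i x) ^+ 2.
Proof. by rewrite sqr_sqrtr // sumr_ge0 // => i _; rewrite sqr_ge0. Qed.

Lemma sum_normc_cabs (I : Type) (s : seq I) (f : I -> R[i]) :
  \sum_(i <- s) `|f i| ^+ 2 = (\sum_(i <- s) cabs (f i) ^+ 2)%:C%C.
Proof.
by rewrite rmorph_sum; apply: eq_bigr => i _; rewrite normc_cabs rmorphXn.
Qed.

(** For an orthonormal [u] the coefficient sum is the squared norm of the combination in L_2. *)
Lemma lincomb_cauchy_schwarz d N (c : 'I_N -> R[i])
    (u : 'I_N -> Rd d -> R[i]) x :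
  cabs (lincomb c u x) ^+ 2 <= (\sum_i cabs (c i) ^+ 2) * wfun u x ^+ 2.
Proof.
have : `|dotmx (\row_i c i) (conj_row u x)| ^+ 2 <=
    dotmx (\row_i c i) (\row_i c i) * dotmx (conj_row u x) (conj_row u x).
  by have [] := CauchySchwarz (@dotmx _ N) (\row_i c i) (conj_row u x).
have dotE (v w : 'rV[R[i]]_N) : dotmx v w = \sum_i v 0 i * Num.conj (w 0 i).
  by rewrite dotmxE mxE; apply: eq_bigr => i _; rewrite !mxE.
rewrite !dotE.
under eq_bigr do rewrite !mxE conjCK.
under [X in _ <= X * _]eq_bigr do rewrite !mxE -normCK.
under [X in _ <= _ * X]eq_bigr do rewrite !mxE -normCK norm_conjC.
by rewrite !sum_normc_cabs normc_cabs -rmorphXn -rmorphM lecR sqr_wfun.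
Qed.

Lemma le_maxabs d m (f : Rd d -> R[i]) (xi : 'I_m -> Rd d) j :
  cabs (f (xi j)) <= maxabs f xi.
Proof. exact: (le_bigmax_cond 0 (fun j => cabs (f (xi j)))). Qed.

Lemma maxabs_ge0 d m (f : Rd d -> R[i]) (xi : 'I_m -> Rd d) : 0 <= maxabs f xi.
Proof. exact: bigmax_ge_id. Qed.

(** With [S] the coefficient sum and [M] the sampled maximum, [N * S <= \sum_j |f (xi j)| ^+ 2 <= 6
    * N * M ^+ 2]. Cancelling [N] and applying Cauchy-Schwarz gives
    [|f| ^+ 2 <= 6 * w ^+ 2 * M ^+ 2]; the constant 3 rounds up the square root of 6. *)
Lemma lincomb_sampling_bound d (Omega : set (Rd d))
    (mu : probability (BorelRd d) R) N (u : 'I_N -> Rd d -> R[i]) :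
  compact Omega -> mu (Omega : set (BorelRd d)) = 1%E ->
  (forall i, ccontinuous_on Omega (u i)) ->
  (forall i j, L2inner mu Omega (u i) (u j) = (i == j)%:R) ->
  exists2 xi : 'I_(6 * N) -> Rd d, forall j, Omega (xi j) &
    forall c x, cabs (lincomb c u x) <= 3 * wfun u x * maxabs (lincomb c u) xi.
Proof.
move=> cO muO.
case: N u => [|n] u cu ou.
  (* For [N = 0] there are no points and the combination vanishes. *)
  exists (fun j : 'I_0 => 0) => [[]//|c x].
  rewrite /lincomb big_ord0 {1}/cabs /= expr0n addr0 sqrtr0.
  by rewrite !mulr_ge0 ?sqrtr_ge0 ?maxabs_ge0.
have large (G : 'M[R[i]]_n.+1) := @conj_row_large_form _ _ _ _ u G cO muO cu ou.
have [xi xiO xiN] := sampling_lower_bound large.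
exists xi => // c x; set M := maxabs _ xi; set S := \sum_i cabs (c i) ^+ 2.
have M0 : 0 <= M := maxabs_ge0 _ _.
have SM : n.+1%:R * S <= n.+1%:R * (6 * M ^+ 2).
  apply: (@le_trans _ _ (\sum_j cabs (lincomb c u (xi j)) ^+ 2)).
    rewrite -lecR -sum_normc_cabs rmorphM rmorph_nat /= /S -sum_normc_cabs.
    have rowE i : (\row_i c i) 0 i = c i by rewrite mxE.
    under [X in _ * X <= _]eq_bigr do rewrite -rowE.
    apply: le_trans (xiN (\row_i c i)) _.
    rewrite le_eqVlt; apply/orP; left; apply/eqP; apply: eq_bigr => j _.
    congr (`|_| ^+ 2); apply: eq_bigr => i _; by rewrite !mxE conjCK.
  apply: (@le_trans _ _ (\sum_(j < 6 * n.+1) M ^+ 2)).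
    apply: ler_sum => j _; rewrite ler_sqr ?nnegrE ?cabs_ge0 //.
    exact: le_maxabs.
  by rewrite sumr_const card_ord -[_ *+ _]mulr_natl natrM mulrAC mulrC mulrA.
rewrite -ler_sqr ?nnegrE ?cabs_ge0 ?mulr_ge0 ?sqrtr_ge0 //.
apply: le_trans (lincomb_cauchy_schwarz c u x) _.
rewrite !exprMn [3 ^+ 2 * _]mulrC -mulrA mulrC ler_wpM2l ?sqr_ge0 //.
move: SM; rewrite ler_pM2l ?ltr0n // => /le_trans; apply.
by rewrite ler_wpM2r ?sqr_ge0 //; lra.
Qed.

(** A supremum dominates its set only if the set is bounded. Boundedness comes from the square of
    [wfun u], a polynomial in continuous real functions. *)
Lemma wfun_le_supnorm d (Omega : set (Rd d)) N (u : 'I_N -> Rd d -> R[i]) x :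
  compact Omega -> (forall i, ccontinuous_on Omega (u i)) -> Omega x ->
  wfun u x <= supnorm Omega (wfun u).
Proof.
move=> cO cu Ox.
have cw : {within Omega, continuous (fun x => wfun u x ^+ 2)}.
  rewrite (_ : (fun x => _) = fun x => \sum_i
      (complex.Re (u i x) * complex.Re (u i x) +
       complex.Im (u i x) * complex.Im (u i x))); last first.
    apply/funext => y; rewrite sqr_wfun; apply: eq_bigr => i _.
    by rewrite sqr_sqrtr ?addr_ge0 ?sqr_ge0.
  apply: within_continuous_sum => i; have [re im] := cu i.
  exact: (within_continuousD (within_continuousM re re)
    (within_continuousM im im)).
have [M wM] := within_continuous_bounded cO cw.
apply: (@le_trans _ _ `|wfun u x|); first exact: ler_norm.
apply: ub_le_sup; last by exists x.
(* [t ^+ 2 <= M] implies [t <= M + 1], as [t <= t ^+ 2 + 1]. *)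
exists (M + 1) => _ [y Oy <-].
have := wM y Oy; rewrite ger0_norm ?sqr_ge0 // ger0_norm ?sqrtr_ge0 //; nra.
Qed.

Theorem theorem2p3 :
  exists C1 C2 : R, 0 < C1 /\ 0 < C2 /\
  forall (d : nat) (Omega : set (Rd d))
         (mu : probability (BorelRd d) R),
    compact Omega ->
    mu (Omega : set (BorelRd d)) = 1%E ->
    forall (N : nat) (u : 'I_N -> Rd d -> R[i]),
      (forall i, ccontinuous_on Omega (u i)) ->
      (forall i j, L2inner mu Omega (u i) (u j) = (i == j)%:R) ->
      exists (m : nat) (xi : 'I_m -> Rd d),
        m%:R <= C1 * N%:R /\
        (forall j, Omega (xi j)) /\
        forall c : 'I_N -> R[i],
          (forall x, Omega x -> 0 < wfun u x ->
             cabs (lincomb c u x) / wfun u x <= C2 * maxabs (lincomb c u) xi) /\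
          supnorm Omega (fun x => cabs (lincomb c u x))
            <= C2 * supnorm Omega (wfun u) * maxabs (lincomb c u) xi.
Proof.
exists 6, 3; split; [by []|split; [by []|]] => d Omega mu cO muO N u cu ou.
have [xi xiO bound] := lincomb_sampling_bound cO muO cu ou.
exists (6 * N)%N, xi; split; [by rewrite natrM|split => // c].
split=> [x _ w0|].
  by rewrite ler_pdivrMr // mulrAC.
(* [ge_sup] asks for a nonempty set; [Omega] is nonempty because it has measure 1. *)
have [x0 Ox0] : Omega !=set0.
  apply/set0P/eqP => O0; move: muO; rewrite O0 measure0 => /eqP.
  by rewrite eq_sym onee_eq0.
apply: ge_sup; first by exists `|cabs (lincomb c u x0)|, x0.
move=> _ [x Ox <-]; rewrite ger0_norm ?cabs_ge0 //.
apply: le_trans (bound c x) _.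
by rewrite ler_wpM2r ?maxabs_ge0 // ler_wpM2l // wfun_le_supnorm.
Qed.
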